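(* Let $S$ be a finite subset of $\mathbb{N}=\{1,2,3,\dots\}$. The following are equivalent: (1) there exist finite digraphs $G$, $H$ and a mapping $f:E(G)\to E(H)$ such that $S=FF(f,G,H)$; (2) there is $n\in\mathbb{N}$ such that $S$ is the set of all positive divisors of $n$.
   Context: Digraphs are finite multidigraphs; loops and parallel edges are allowed. For an abelian group $M$, a map $\varphi:E(G)\to M$ is an $M$-flow if at every vertex $v$ the sum of $\varphi$ over edges leaving $v$ equals the sum of $\varphi$ over edges entering $v$. A mapping $f:E(G)\to E(H)$ is $M$-flow-continuous if for every $M$-flow $\varphi$ on $H$ the composition $\varphi\circ f$ is an $M$-flow on $G$. For a mapping $f:E(G)\to E(H)$, we set $FF(f,G,H)=\{n\ge 1: f \text{ is } \mathbb{Z}_n\text{-flow-continuous}\}$. *)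

(* Defs.v *)
From HB Require Import structures.
From mathcomp Require Import all_boot all_order all_algebra.
From mathcomp Require Import all_classical.

Set Implicit Arguments.
Unset Strict Implicit.
Unset Printing Implicit Defensive.

Import GRing.Theory.
Local Open Scope ring_scope.
Local Open Scope classical_set_scope.

(* Loops and parallel edges are allowed: [src] and [tgt] are arbitrary. *)
Record digraph : Type := Digraph {
  vertex : finType;
  edge : finType;
  src : edge -> vertex;
  tgt : edge -> vertex
}.

Definition is_flow (M : zmodType) (G : digraph) (phi : edge G -> M) : Prop :=
  forall v : vertex G,
    \sum_(e : edge G | src e == v) phi e = \sum_(e : edge G | tgt e == v) phi e.

Definition flow_continuous (M : zmodType) (G H : digraph)
    (f : edge G -> edge H) : Prop :=
  forall phi : edge H -> M, is_flow phi -> is_flow (phi \o f).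

(* For n >= 1 this is Z/nZ, the trivial group for n = 1. The notation ['Z_n] is
   not used because ['Z_1] is Z/2Z. *)
Definition Zmod (n : nat) : zmodType := 'I_n.-1.+1.

Definition FF (G H : digraph) (f : edge G -> edge H) : set nat :=
  [set n : nat | (1 <= n)%N /\ flow_continuous (Zmod n) f].

(* Main.v *)
Require Import Defs.
From mathcomp Require Import all_boot all_order all_algebra.
From mathcomp Require Import all_classical.

Local Open Scope classical_set_scope.

(** [FF f] is closed under divisors, because multiplication by [q] embeds
    [Z_d] into [Z_(q d)], and under least common multiples, because [Z_lcm(a,b)]
    embeds into [Z_a x Z_b]. A finite set of positive integers which contains 1
    and has these closure properties is the set of divisors of the lcm of its
    elements. Conversely, the divisors of [n] are realized by mapping [n]
    parallel edges to a single loop: the flow [x] on the loop is pulled back to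
    a flow exactly when [n x = 0]. *)

(* Residues are represented by arbitrary naturals so that flows for different
   moduli can be compared without casts. *)
Definition modflow (d : nat) {G : digraph} (phi : edge G -> nat) : Prop :=
  forall v : vertex G,
    \sum_(e : edge G | src e == v) phi e
    = \sum_(e : edge G | tgt e == v) phi e %[mod d].

Lemma val_Zmod_sum (d : nat) (I : finType) (P : pred I) (F : I -> Zmod d) :
  (0 < d)%N ->
  nat_of_ord (\sum_(i | P i) F i)%R = (\sum_(i | P i) nat_of_ord (F i)) %% d.
Proof.
case: d F => // d F _.
elim/big_rec2: _ => [|i m x _ IH]; first by rewrite mod0n.
by rewrite /= IH modnDmr.
Qed.

Lemma is_flow_Zmod {d : nat} {G : digraph} {phi : edge G -> Zmod d} :
  (0 < d)%N -> is_flow phi <-> modflow d (fun e => nat_of_ord (phi e)).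
Proof.
move=> d_gt0; split=> flow v.
  by rewrite -!val_Zmod_sum // flow.
by apply: ord_inj; rewrite !val_Zmod_sum //; apply: flow.
Qed.

Lemma eq_modflow (d : nat) {G : digraph} (phi psi : edge G -> nat) :
  (forall e, phi e = psi e %[mod d]) -> modflow d phi -> modflow d psi.
Proof.
move=> eq_phi flow v.
have eq_sum (P : pred (edge G)) :
    \sum_(e | P e) phi e = \sum_(e | P e) psi e %[mod d].
  elim/big_rec2: _ => // e x y _ IH.
  by rewrite -modnDm eq_phi IH modnDm.
by rewrite -!eq_sum.
Qed.

(** Reducing a natural-valued flow to its residues below [d] changes neither the flow condition
    modulo [d] nor that of its pullback; conversely, elements of [Zmod d] are already naturals. *)
Lemma flow_continuous_Zmod {d : nat} {G H : digraph} {f : edge G -> edge H} :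
  (0 < d)%N ->
  flow_continuous (Zmod d) f <->
  (forall phi, modflow d phi -> modflow d (phi \o f)).
Proof.
move=> d_gt0; split=> fc phi flow.
- pose psi e : Zmod d := inZp (phi e).
  (* [inZp] reduces modulo [d.-1.+1], which is [d] because [d] is positive. *)
  have psiE e : nat_of_ord (psi e) = phi e %% d by rewrite /= prednK.
  apply: (eq_modflow d (fun e => nat_of_ord (psi (f e)))) => [e|].
    by rewrite psiE modn_mod.
  apply/(@is_flow_Zmod d G (psi \o f) d_gt0); apply: fc.
  apply/(is_flow_Zmod d_gt0).
  by apply: eq_modflow flow => e; rewrite psiE modn_mod.
- apply/(is_flow_Zmod d_gt0); apply: (fc (fun e => nat_of_ord (phi e))).
  exact/(is_flow_Zmod d_gt0).
Qed.

(** The factor [q] comes out of both sums, and it cancels from a congruence modulo [q * d], leaving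
    one modulo [d]. *)
Lemma modflowM {q d : nat} {G : digraph} {phi : edge G -> nat} :
  (0 < q)%N -> modflow (q * d) (fun e => q * phi e) <-> modflow d phi.
Proof.
move=> q_gt0; split=> flow v; have := flow v.
  rewrite -!big_distrr /= -!muln_modr => /eqP.
  by rewrite eqn_pmul2l // => /eqP.
by move=> eq_sum; rewrite -!big_distrr /= -!muln_modr eq_sum.
Qed.

Lemma eqn_mod_lcm (a b x y : nat) :
  (x == y %[mod lcmn a b]) = (x == y %[mod a]) && (x == y %[mod b]).
Proof.
(* With [y <= x] the truncated difference [x - y] is the true one, so each congruence becomes a
   divisibility of [x - y]. *)
wlog le_yx : x y / (y <= x)%N.
  move=> IH; case/orP: (leq_total y x) => [/IH//|/IH].
  by rewrite ![y %% _ == _]eq_sym.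
by rewrite !eqn_mod_dvd // dvdn_lcm.
Qed.

Lemma modflow_lcm (a b : nat) (G : digraph) (phi : edge G -> nat) :
  modflow (lcmn a b) phi <-> modflow a phi /\ modflow b phi.
Proof.
split=> [flow|[flow_a flow_b] v].
  by split=> v; have /eqP := flow v; rewrite eqn_mod_lcm => /andP[/eqP ? /eqP ?].
by apply/eqP; rewrite eqn_mod_lcm; apply/andP; split; apply/eqP.
Qed.

Section FlowContinuityModuli.

Variables (G H : digraph) (f : edge G -> edge H).

Lemma FF1 : FF f 1.
Proof.
by split=> //; apply/flow_continuous_Zmod => // phi _ v; rewrite !modn1.
Qed.

Lemma FF_dvdn (d n : nat) : (d %| n)%N -> FF f n -> FF f d.
Proof.
case/dvdnP=> q -> [qd_gt0 /(flow_continuous_Zmod qd_gt0) fc].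
have [q_gt0 d_gt0] : (0 < q)%N /\ (0 < d)%N.
  by apply/andP; rewrite -muln_gt0.
split=> //; apply/(flow_continuous_Zmod d_gt0) => phi flow.
(* Scaling by [q] commutes with composition with [f], so continuity modulo [q * d] applies to the
   scaled flow. *)
apply/(modflowM q_gt0); apply: (fc (fun e => q * phi e)).
exact/(modflowM q_gt0).
Qed.

Lemma FF_lcmn (a b : nat) : FF f a -> FF f b -> FF f (lcmn a b).
Proof.
move=> [a_gt0 /(flow_continuous_Zmod a_gt0) fc_a].
move=> [b_gt0 /(flow_continuous_Zmod b_gt0) fc_b].
have lcm_gt0 : (0 < lcmn a b)%N by rewrite lcmn_gt0 a_gt0.
split=> //; apply/(flow_continuous_Zmod lcm_gt0) => phi.
by move=> /modflow_lcm[/fc_a flow_a /fc_b flow_b]; apply/modflow_lcm.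
Qed.

End FlowContinuityModuli.

Lemma finite_divisor_lcm_closed (S : set nat) :
  finite_set S -> S `<=` [set n | (0 < n)%N] -> S 1%N ->
  (forall d n, (d %| n)%N -> S n -> S d) ->
  (forall a b, S a -> S b -> S (lcmn a b)) ->
  exists n, (0 < n)%N /\ S = [set d | (0 < d)%N /\ (d %| n)%N].
Proof.
move=> /finite_seqP[s sE] S_pos S1 S_dvd S_lcm.
pose n := \big[lcmn/1%N]_(x <- s) x.
have Sn : S n.
  (* The empty lcm is 1, so [S 1] starts the induction and lcm-closure carries it on. *)
  by rewrite /n big_seq; elim/big_ind: _ => // x xs; rewrite sE.
exists n; split; first exact: S_pos.
apply/seteqP; split=> [d Sd | d [_ d_n]]; last exact: S_dvd d_n Sn.
split; first exact: S_pos.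
have ds : d \in s by move: Sd; rewrite sE.
by rewrite /n (big_rem d) //= dvdn_lcml.
Qed.

Definition loop : digraph := @Digraph unit unit id id.

Definition parallel_edges (n : nat) : digraph :=
  @Digraph bool 'I_n (fun=> false) (fun=> true).

Lemma FF_parallel_edges_loop (n : nat) :
  FF (fun _ : edge (parallel_edges n) => tt : edge loop)
  = [set d | (0 < d)%N /\ (d %| n)%N].
Proof.
apply/seteqP; split=> d [d_gt0].
  move=> /(flow_continuous_Zmod d_gt0) fc; split=> //.
  (* Test the constant flow 1 at the common tail [false]: [n] edges leave it and none enter, so [n]
     vanishes modulo [d]. *)
  have /fc/(_ false) : @modflow d loop (fun=> 1%N) by [].
  rewrite /= big_pred0_eq sum1_card card_ord mod0n => /eqP; exact.
move=> d_n; split=> //; apply/(flow_continuous_Zmod d_gt0) => phi _ v.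
have sum0 : \sum_(e : 'I_n) phi tt = 0 %[mod d].
  by rewrite sum_nat_const card_ord mod0n; apply/eqP; exact: dvdn_mulr.
by case: v; rewrite /= big_pred0_eq sum0.
Qed.

Theorem theorem2p6 (S : set nat) (S_fin : finite_set S)
    (S_pos : S `<=` [set n : nat | (1 <= n)%N]) :
  (exists (G H : digraph) (f : edge G -> edge H), S = FF f)
  <->
  (exists n : nat, (1 <= n)%N /\ S = [set d : nat | (1 <= d)%N /\ (d %| n)%N]).
Proof.
split=> [[G [H [f SE]]]|[n [_ ->]]].
  apply: finite_divisor_lcm_closed => //; rewrite SE.
  - exact: FF1.
  - exact: FF_dvdn.
  - exact: FF_lcmn.
by exists (parallel_edges n), loop, (fun=> tt); rewrite FF_parallel_edges_loop.
Qed.
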